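(* Let $W_{\boldsymbol\lambda}\in\boldsymbol B(\ell^2)$ be a CPD unilateral weighted shift of type I or of type II. If $W_{\boldsymbol\lambda}$ is not subnormal, then $W_{\boldsymbol\lambda}$ is not similar to any subnormal operator.
   Context: $\mathbb Z_+=\{0,1,2,\dots\}$, $\mathbb R_+=[0,\infty)$; $\boldsymbol B(\mathcal H,\mathcal K)$ denotes bounded linear operators between complex Hilbert spaces, $\boldsymbol B(\mathcal H)=\boldsymbol B(\mathcal H,\mathcal H)$; $\{e_n\}_{n=0}^\infty$ is the standard orthonormal basis of $\ell^2=\ell^2(\mathbb Z_+)$. Unilateral weighted shift: for a bounded sequence $\boldsymbol\lambda=\{\lambda_n\}_{n=0}^\infty\subseteq(0,\infty)$, $W_{\boldsymbol\lambda}\in\boldsymbol B(\ell^2)$ is the operator with $W_{\boldsymbol\lambda}e_n=\lambda_n e_{n+1}$, $n\in\mathbb Z_+$. Put $\hat\lambda_0=1$ and $\hat\lambda_n=\lambda_0^2\cdots\lambda_{n-1}^2$ for $n\geqslant1$. CPD: $T\in\boldsymbol B(\mathcal H)$ is conditionally positive definite (CPD) if for every $h\in\mathcal H$ the sequence $\gamma_n=\|T^nh\|^2$ satisfies $\sum_{i,j=0}^k\gamma_{i+j}\alpha_i\bar\alpha_j\geqslant0$ for all finite complex sequences $\alpha_0,\dots,\alpha_k$ with $\sum_{j=0}^k\alpha_j=0$. Scalar representing triplet: let $Q_0=Q_1=0$ and $Q_n(x)=\sum_{j=0}^{n-2}(n-j-1)x^j$ for $n\geqslant2$. It is known that $W_{\boldsymbol\lambda}$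 is CPD if and only if there are $\mathfrak b\in\mathbb R$, $\mathfrak c\in\mathbb R_+$ and a compactly supported finite positive Borel measure $\nu$ on $\mathbb R_+$ with $\nu(\{1\})=0$ such that $\hat\lambda_n=1+\mathfrak bn+\mathfrak cn^2+\int_{\mathbb R_+}Q_n\,\mathrm d\nu$ for all $n\in\mathbb Z_+$; the triplet $(\mathfrak b,\mathfrak c,\nu)$ is then unique and is called the scalar representing triplet of $W_{\boldsymbol\lambda}$. Types: a CPD unilateral weighted shift with scalar representing triplet $(\mathfrak b,\mathfrak c,\nu)$ is of type I if $\nu=0$ and $\mathfrak c=0$; of type II if $\operatorname{supp}\nu=\{0\}$ and $\mathfrak c=0$; of type III if $\operatorname{supp}\nu\nsubseteq\{0\}$ or $\mathfrak c\neq0$. Operators $A\in\boldsymbol B(\mathcal H)$, $B\in\boldsymbol B(\mathcal K)$ are similar if $YA=BY$ for some bijective $Y\in\boldsymbol B(\mathcal H,\mathcal K)$. *)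

(* Defs.v *)
From HB Require Import structures.
From mathcomp Require Import all_boot all_order all_algebra.
From mathcomp Require Import sesquilinear complex.
From mathcomp Require Import ring lra.
From mathcomp Require Import all_classical all_reals all_analysis.

Set Implicit Arguments.
Unset Strict Implicit.
Unset Printing Implicit Defensive.

Import Order.TTheory GRing.Theory Num.Theory.
Import numFieldNormedType.Exports.
Import Normc.

Local Open Scope classical_set_scope.
Local Open Scope ring_scope.

(* Complex scalars are R[i]; norms take values in R[i] and are nonnegative
   reals there. The inner product is linear in its first argument. *)
HB.mixin Record isHilbert (R : realType) H & CompleteNormedModule R[i] H := {
  dotp : {dot H for @Num.conj R[i]} ;
  dotp_norm : forall x : H, dotp x x = `|x| ^+ 2 }.

#[short(type="hilbertType")]
HB.structure Definition Hilbert (R : realType) :=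
  {H of CompleteNormedModule R[i] H & isHilbert R H}.

HB.mixin Record isBoundedOperator (R : realType) (H K : hilbertType R)
    (f : H -> K) := {
  bounded_op : exists M : R[i], forall x, `|f x| <= M * `|x| }.

#[short(type="boundedOperator")]
HB.structure Definition BoundedOperator (R : realType) (H K : hilbertType R) :=
  {f of @GRing.Linear R[i] H K *:%R f & isBoundedOperator R H K f}.

Notation "''B' ( H , K )" := (boundedOperator H K)
  (at level 8, format "''B' ( H ,  K )") : type_scope.
Notation "''B' ( H )" := (boundedOperator H H)
  (at level 8, format "''B' ( H )") : type_scope.

Section operators.
Context {R : realType}.

Definition is_adjoint (H K : hilbertType R) (T : 'B(H, K)) (S : 'B(K, H)) :=
  forall x y, dotp (T x) y = dotp x (S y).

Definition normal_op (H : hilbertType R) (N : 'B(H)) :=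
  exists2 S : 'B(H), is_adjoint N S & N \o S =1 S \o N.

(* The inclusion of H into the larger space K is represented by a linear map J
   preserving inner products. *)
Definition subnormal_op (H : hilbertType R) (T : 'B(H)) :=
  exists (K : hilbertType R) (J : {linear H -> K}) (N : 'B(K)),
    [/\ isometry (@dotp R K) (@dotp R H) J, normal_op N & N \o J =1 J \o T].

Definition similar_op (H K : hilbertType R) (A : 'B(H)) (B : 'B(K)) :=
  exists2 Y : 'B(H, K), bijective Y & Y \o A =1 B \o Y.

Definition cpd_op (H : hilbertType R) (T : 'B(H)) :=
  forall (h : H) (k : nat) (a : 'I_k.+1 -> R[i]),
    \sum_j a j = 0 ->
    0 <= \sum_(i < k.+1) \sum_(j < k.+1)
           `|iter (i + j) T h| ^+ 2 * a i * (a j)^*.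

End operators.

Section ell2_def.
Variable R : realType.
Implicit Types (x y z : nat -> R[i]) (w : R[i]).

Definition ell2_pred : {pred nat -> R[i]} :=
  fun x => `[< cvgn (series (fun n => normc (x n) ^+ 2)) >].

Lemma normc2E w : normc w ^+ 2 = complex.Re w ^+ 2 + complex.Im w ^+ 2.
Proof. by case: w => a b /=; rewrite sqr_sqrtr // addr_ge0 ?sqr_ge0. Qed.

Lemma normc2_ge0 w : 0 <= normc w ^+ 2.
Proof. exact: sqr_ge0. Qed.

Lemma ell2_predP x : x \in ell2_pred <->
  exists M : R, forall n, \sum_(k < n) normc (x k) ^+ 2 <= M.
Proof.
rewrite inE; split => [xc | [M xM]].
  have [M /= HM] := bounded_fun_has_ubound (cvg_seq_bounded xc).
  exists M => n; apply: HM; exists n => //.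
  by rewrite /series /= big_mkord.
apply: nondecreasing_is_cvgn.
  by apply: nondecreasing_series => *; exact: normc2_ge0.
exists M => _ [n _ <-]; rewrite /series /= big_mkord; exact: xM.
Qed.

Lemma ell2_submod_closed : GRing.submod_closed ell2_pred.
Proof.
split=> [|a x y /ell2_predP[M xM] /ell2_predP[L yL]]; apply/ell2_predP.
  by exists 0 => n; rewrite big1 // => i _; rewrite normc0 expr0n.
exists (2 * normc a ^+ 2 * M + 2 * L) => n.
apply: (@le_trans _ _ (\sum_(k < n) (2 * normc a ^+ 2 * normc (x k) ^+ 2
   + 2 * normc (y k) ^+ 2))).
  apply: ler_sum => k _.
  rewrite -mulrA -exprMn -normcM -[in leLHS]/(normc (a * x k + y k) ^+ 2) !normc2E.
  rewrite raddfD /= [complex.Im (_ + _)]raddfD /=.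
  set p := complex.Re _; set q := complex.Re _; set r := complex.Im _; set s := complex.Im _.
  have := sqr_ge0 (p - q); have := sqr_ge0 (r - s).
  rewrite !sqrrB !sqrrD; lra.
rewrite big_split /= -!mulr_sumr; apply: lerD; apply: ler_wpM2l => //; [|exact: xM|exact: yL].
by apply: mulr_ge0 => //; exact: normc2_ge0.
Qed.

Record ell2 := Ell2 { ell2_val :> nat -> R[i]; ell2P : ell2_val \in ell2_pred }.

HB.instance Definition _ := [isSub for ell2_val].
HB.instance Definition _ := [Choice of ell2 by <:].
HB.instance Definition _ := GRing.isSubmodClosed.Build R[i] (nat -> R[i]) ell2_pred
  ell2_submod_closed.
HB.instance Definition _ := [SubChoice_isSubLmodule of ell2 by <:].

End ell2_def.

Section ell2_hilbert.
Variable R : realType.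
Implicit Types (x y z : ell2 R) (w : R[i]).
Local Notation ell2 := (ell2 R).

Lemma ell2D (x y : ell2) n : (x + y) n = x n + y n. Proof. by []. Qed.
Lemma ell2Z w (x : ell2) n : (w *: x) n = w * x n. Proof. by []. Qed.
Lemma ell2N (x : ell2) n : (- x) n = - x n. Proof. by []. Qed.
Lemma ell2_0 n : (0 : ell2) n = 0. Proof. by []. Qed.

Lemma ell2_ext (x y : ell2) : (forall n, x n = y n) -> x = y.
Proof. by move=> xy; apply: val_inj; apply/funext. Qed.

Definition ell2_dot (x y : ell2) : R[i] :=
  (limn (series (fun n => complex.Re (x n * (y n)^*))) +i*
   limn (series (fun n => complex.Im (x n * (y n)^*))))%C.

Let sq (x : ell2) := fun n => normc (x n) ^+ 2.
Let S (x : ell2) := limn (series (sq x)).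

Let cvgS x : cvgn (series (sq x)).
Proof. by have := ell2P x; rewrite inE. Qed.

Let S_ge (x : ell2) n : \sum_(k < n) sq x k <= S x.
Proof.
have := nondecreasing_cvgn_le (nondecreasing_series (u_ := sq x)
   (P := xpredT) (fun k _ _ => normc2_ge0 (x k))) (@cvgS x) n.
by rewrite /series /= big_mkord.
Qed.

Let S_le (x : ell2) M : (forall n, \sum_(k < n) sq x k <= M) -> S x <= M.
Proof.
move=> h; apply: limr_le; first exact: cvgS.
by near=> n; rewrite /series /= big_mkord.
Unshelve. all: by end_near. Qed.

Let S_ge0 x : 0 <= S x.
Proof. by have := S_ge x 0; rewrite big_ord0. Qed.

Let cvg_dom (x y : ell2) (f : nat -> R) :
  (forall n, `|f n| <= normc (x n) ^+ 2 + normc (y n) ^+ 2) ->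
  cvgn (series f).
Proof.
move=> h; apply: normed_cvg; apply: (@series_le_cvg _ _ (sq x + sq y)) => //=.
- by move=> n; rewrite addr_ge0 ?sqr_ge0.
- exact: is_cvg_seriesD.
Qed.

Let cvgRe (x y : ell2) :
  cvgn (series (fun n => complex.Re (x n * (y n)^*))).
Proof.
apply: (@cvg_dom x y) => n; rewrite !normc2E.
case: (x n) (y n) => a b [c d] /=; rewrite ler_norml.
have := sqr_ge0 (a - c); have := sqr_ge0 (b - d).
have := sqr_ge0 (a + c); have := sqr_ge0 (b + d).
rewrite !sqrrB !sqrrD; lra.
Qed.

Let cvgIm (x y : ell2) :
  cvgn (series (fun n => complex.Im (x n * (y n)^*))).
Proof.
apply: (@cvg_dom x y) => n; rewrite !normc2E.
case: (x n) (y n) => a b [c d] /=; rewrite ler_norml.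
have := sqr_ge0 (a - d); have := sqr_ge0 (b - c).
have := sqr_ge0 (a + d); have := sqr_ge0 (b + c).
rewrite !sqrrB !sqrrD; lra.
Qed.

Let lim3 (f g h : nat -> R) (p q : R) :
  cvgn (series f) -> cvgn (series g) -> cvgn (series h) ->
  limn (series (fun n => p * f n + q * g n + h n)) =
  p * limn (series f) + q * limn (series g) + limn (series h).
Proof.
move=> cf cg ch.
have -> : (fun n => p * f n + q * g n + h n) = p *: f + q *: g + h by [].
have cpf : cvgn (series (p *: f)) by exact: is_cvg_seriesZ.
have cqg : cvgn (series (q *: g)) by exact: is_cvg_seriesZ.
have cpq : cvgn (series (p *: f + q *: g)) by exact: is_cvg_seriesD.
by rewrite (lim_seriesD cpq ch) (lim_seriesD cpf cqg) (lim_seriesZ _ cf) (lim_seriesZ _ cg).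
Qed.

Lemma ell2_dotC x y : ell2_dot x y = (ell2_dot y x)^*.
Proof.
rewrite /ell2_dot /=; congr (_ +i* _)%C.
  congr (limn (series _)); apply/funext => n.
  by case: (x n) (y n) => a b [c d] /=; ring.
rewrite -lim_seriesN //; congr (limn (series _)); apply/funext => n.
rewrite -[RHS]/(- complex.Im (y n * (x n)^*)).
by case: (x n) (y n) => a b [c d] /=; ring.
Qed.

Lemma ell2_dotl y : scalar (ell2_dot^~ y).
Proof.
move=> [p q] x z; rewrite /ell2_dot /=.
rewrite [LHS](_ : _ = (
   limn (series (fun n => p * complex.Re (x n * (y n)^*)
     + (- q) * complex.Im (x n * (y n)^*) + complex.Re (z n * (y n)^*))) +i*
   limn (series (fun n => q * complex.Re (x n * (y n)^*)
     + p * complex.Im (x n * (y n)^*) + complex.Im (z n * (y n)^*))))%C).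
  rewrite !lim3 //; apply/eqP; rewrite eq_complex /=; apply/andP; split;
  by apply/eqP; ring.
congr (limn (series _) +i* limn (series _))%C; apply/funext => n;
  rewrite -[(_ + _) n]/((p +i* q)%C * x n + z n);
  case: (x n) (y n) (z n) => a b [c d] [e f] /=; ring.
Qed.

Lemma ell2_dotxx x : ell2_dot x x = (S x)%:C%C.
Proof.
rewrite /ell2_dot /S; congr (_ +i* _)%C.
  congr (limn (series _)); apply/funext => n; rewrite /sq normc2E.
  by case: (x n) => a b /=; ring.
rewrite [X in series X](_ : _ = cst 0); last first.
  by apply/funext => n; case: (x n) => a b /=; ring.
rewrite [X in limn X](_ : _ = cst 0) ?lim_cst //.
by apply/funext => n; rewrite /series /= big1.
Qed.

Let S_eq0 x : S x = 0 -> x = 0.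
Proof.
move=> Sx; apply: ell2_ext => n; apply: eq0_normc; apply/eqP.
rewrite -sqrf_eq0 eq_le sqr_ge0 andbT -Sx.
apply: le_trans (S_ge x n.+1); rewrite big_ord_recr /= lerDr.
by apply: sumr_ge0 => k _; exact: normc2_ge0.
Qed.

Let ell2_dotr x : GRing.linear_for (@Num.conj R[i] \; *%R) (ell2_dot x).
Proof.
move=> w y z.
by rewrite ell2_dotC ell2_dotl rmorphD rmorphM /= -!ell2_dotC.
Qed.

HB.instance Definition _ :=
  bilinear_isBilinear.Build R[i] ell2 ell2 R[i] *%R (@Num.conj R[i] \; *%R)
    ell2_dot (ell2_dotl, ell2_dotr).

Let ell2_dot_herm x y : ell2_dot x y = (-1) ^+ false * (ell2_dot y x)^*.
Proof. by rewrite expr0 mul1r -ell2_dotC. Qed.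

HB.instance Definition _ :=
  isHermitianSesquilinear.Build R[i] ell2 false (@Num.conj R[i]) ell2_dot
    ell2_dot_herm.

Let ell2_dot_gt0 x : x != 0 -> 0 < ell2_dot x x.
Proof.
move=> x0; rewrite ell2_dotxx ltcR lt_def S_ge0 andbT.
by apply: contra x0 => /eqP/S_eq0 ->.
Qed.

HB.instance Definition _ :=
  isDotProduct.Build R[i] ell2 ell2_dot ell2_dot_gt0.

Definition ell2_norm x : R[i] :=
  (Num.sqrt (limn (series (fun n => normc (x n) ^+ 2))))%:C%C.

Let N x := Num.sqrt (S x).

Let N2 x : N x ^+ 2 = S x. Proof. exact: sqr_sqrtr. Qed.

Let N_ge0 x : 0 <= N x. Proof. exact: sqrtr_ge0. Qed.

Let dotDl x y z : ell2_dot (x + y) z = ell2_dot x z + ell2_dot y z.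
Proof. by have := ell2_dotl z 1 x y; rewrite scale1r mul1r. Qed.

Let dot0l x : ell2_dot 0 x = 0.
Proof. by apply: (addrI (ell2_dot 0 x)); rewrite -dotDl !addr0. Qed.

Let dotZl w x y : ell2_dot (w *: x) y = w * ell2_dot x y.
Proof. by have := ell2_dotl y w x 0; rewrite dot0l !addr0. Qed.

Let dotDr x y z : ell2_dot x (y + z) = ell2_dot x y + ell2_dot x z.
Proof. by rewrite ell2_dotC dotDl rmorphD /= -!ell2_dotC. Qed.

Let dotZr w x y : ell2_dot x (w *: y) = w^* * ell2_dot x y.
Proof. by rewrite ell2_dotC dotZl rmorphM /= -!ell2_dotC. Qed.

Let SD x y : S (x + y) = S x + S y + 2 * complex.Re (ell2_dot x y).
Proof.
have := congr1 (@complex.Re R) (ell2_dotxx (x + y)).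
rewrite dotDl !dotDr !ell2_dotxx [ell2_dot y x]ell2_dotC /= => <-.
by case: (ell2_dot x y) => a b /=; ring.
Qed.

Let SZ w x : S (w *: x) = normc w ^+ 2 * S x.
Proof.
rewrite /S -[RHS](lim_seriesZ _ (@cvgS x)); congr (limn (series _)).
by apply/funext => n; rewrite /sq ell2Z normcM exprMn.
Qed.

Let Re_dot_le x y : complex.Re (ell2_dot x y) <= N x * N y.
Proof.
have [Nx0|Nx0] := eqVneq (N x) 0.
  have x0 : x = 0 by apply: S_eq0; rewrite -N2 Nx0 expr0n.
  by rewrite Nx0 mul0r x0 dot0l.
have [Ny0|Ny0] := eqVneq (N y) 0.
  have y0 : y = 0 by apply: S_eq0; rewrite -N2 Ny0 expr0n.
  by rewrite Ny0 mulr0 ell2_dotC y0 dot0l conjC0.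
have Nx : 0 < N x by rewrite lt_def Nx0 N_ge0.
have Ny : 0 < N y by rewrite lt_def Ny0 N_ge0.
rewrite -subr_ge0 -(pmulr_rge0 _ (mulr_gt0 Nx Ny)).
have := S_ge0 (((- N y)%:C)%C *: x + ((N x)%:C)%C *: y).
rewrite SD !SZ -!N2 dotZl dotZr !normc2E /=.
by case: (ell2_dot x y) => a b /=; lra.
Qed.

Let ell2_normE x : ell2_norm x = (N x)%:C%C. Proof. by []. Qed.

Let ler_ell2D x y : ell2_norm (x + y) <= ell2_norm x + ell2_norm y.
Proof.
rewrite !ell2_normE -rmorphD lecR -(@ler_pXn2r _ 2) ?nnegrE ?addr_ge0 ?N_ge0 //.
by rewrite sqrrD !N2 SD; have := Re_dot_le x y; lra.
Qed.

Let ell2_normZ w x : ell2_norm (w *: x) = `|w| * ell2_norm x.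
Proof.
rewrite !ell2_normE /N SZ sqrtrM ?sqr_ge0 // sqrtr_sqr ger0_norm.
  by rewrite rmorphM /= [`|w|]normc_def; case: w.
by case: w => a b; exact: sqrtr_ge0.
Qed.

Let ell2_norm_eq0 x : ell2_norm x = 0 -> x = 0.
Proof.
move=> /(congr1 (@complex.Re R)) Nx; apply: S_eq0.
by rewrite -N2 [N x]Nx expr0n.
Qed.

HB.instance Definition _ :=
  Lmodule_isNormed.Build R[i] ell2 ler_ell2D ell2_normZ ell2_norm_eq0.

Let normE x : `|x| = (N x)%:C%C. Proof. by []. Qed.

Let normc_le x n : normc (x n) <= N x.
Proof.
rewrite -(@ler_pXn2r _ 2) ?nnegrE ?N_ge0 //; last first.
  by case: (x n) => a b; exact: sqrtr_ge0.
rewrite N2; apply: le_trans (S_ge x n.+1); rewrite big_ord_recr /= lerDr.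
by apply: sumr_ge0 => k _; exact: normc2_ge0.
Qed.

Let Re_le w : `|complex.Re w| <= normc w.
Proof.
by rewrite -sqrtr_sqr; case: w => a b /=; rewrite ler_wsqrtr // lerDl sqr_ge0.
Qed.

Let Im_le w : `|complex.Im w| <= normc w.
Proof.
by rewrite -sqrtr_sqr; case: w => a b /=; rewrite ler_wsqrtr // lerDr sqr_ge0.
Qed.

Let ell2_complete (F : set_system ell2) : ProperFilter F -> cauchy F -> cvg F.
Proof.
move=> FF /cauchy_ballP Fc.
have Fe (e : R) : 0 < e -> \forall x & y \near F, N (x - y) < e.
  move=> e0; have e0' : 0 < e%:C%C :> R[i] by rewrite ltcR.
  have := Fc _ e0'; apply: filterS => -[x y] /=.
  by rewrite -ball_normE /= normE ltcR.
have lip (f : ell2 -> R) : (forall x y, `|f x - f y| <= N (x - y)) ->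
    cvg (f @ F).
  move=> hf; apply/cauchy_cvgP/cauchy_ballP => e e0; near_simpl.
  have := Fe e e0; apply: filterS => -[x y] /=; rewrite -ball_normE /=.
  exact: le_lt_trans.
pose l n := (lim ((fun x : ell2 => complex.Re (x n)) @ F) +i*
   lim ((fun x : ell2 => complex.Im (x n)) @ F))%C.
have lRe n : (fun x : ell2 => complex.Re (x n)) @ F --> complex.Re (l n).
  apply: lip => x y; rewrite -raddfB; exact: le_trans (Re_le _) (normc_le (x - y) n).
have lIm n : (fun x : ell2 => complex.Im (x n)) @ F --> complex.Im (l n).
  apply: lip => x y; rewrite -raddfB; exact: le_trans (Im_le _) (normc_le (x - y) n).
have xl (e : R) : 0 < e -> \forall x \near F,
    forall n, \sum_(k < n) normc ((x : ell2) k - l k) ^+ 2 <= e ^+ 2.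
  move=> e0; have H : \forall x \near F, \forall y \near F, N (x - y) < e.
    by apply: nearP_dep; exact: Fe.
  near=> x => n; have xF : \forall y \near F, N (x - y) < e by near: x.
  have cv : (fun y : ell2 => \sum_(k < n)
      ((complex.Re (x k) - complex.Re (y k)) ^+ 2 +
       (complex.Im (x k) - complex.Im (y k)) ^+ 2)) @ F -->
     \sum_(k < n) ((complex.Re (x k) - complex.Re (l k)) ^+ 2 +
       (complex.Im (x k) - complex.Im (l k)) ^+ 2).
    apply: cvg_big => [|k _]; first exact: add_continuous.
    apply: cvgD; apply: cvgM; apply: cvgB => //;
      exact: cvg_cst.
  have nE (u v : nat -> R[i]) : \sum_(k < n) normc (u k - v k) ^+ 2 =
    \sum_(k < n) ((complex.Re (u k) - complex.Re (v k)) ^+ 2 +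
       (complex.Im (u k) - complex.Im (v k)) ^+ 2).
    by apply: eq_bigr => k _; rewrite normc2E; case: (u k) (v k) => a b [c d].
  rewrite nE; apply: (closed_cvg (fun r => r <= e ^+ 2)) cv.
    exact: closed_le.
  move: xF; apply: filterS => y xy; rewrite -nE.
  apply: le_trans (S_ge (x - y) n) _; rewrite -N2.
  by rewrite lerXn2r ?nnegrE ?N_ge0 ?ltW.
have /filter_ex [x0 x0P] := xl 1 ltr01.
have x0l : (fun n => x0 n - l n) \in @ell2_pred R.
  by apply/ell2_predP; exists (1 ^+ 2).
pose d := Ell2 x0l.
have lE n : (x0 - d) n = l n.
  by rewrite -[LHS]/(x0 n - (x0 n - l n)) subKr.
apply/cvg_ex; exists (x0 - d); apply/cvgrPdist_le => e e0.
have /complex_realP [r er] := gtr0_real e0.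
have r0 : 0 < r by rewrite -ltcR -er.
have := xl r r0; apply: filterS => x xP.
rewrite distrC normE er lecR -(@ler_pXn2r _ 2) ?nnegrE ?N_ge0 ?(ltW r0) //.
rewrite N2; apply: S_le => n; apply: le_trans (xP n).
apply: ler_sum => k _; rewrite /sq.
by rewrite -[(x - _) k]/(x k - (x0 - d) k) lE.
Unshelve. all: by end_near. Qed.

HB.instance Definition _ := Uniform_isComplete.Build ell2 ell2_complete.

Let ell2_dot_norm x :
  (ell2_dot : {dot ell2 for @Num.conj R[i]}) x x = `|x| ^+ 2.
Proof. by rewrite /= ell2_dotxx normE -N2 rmorphXn. Qed.

HB.instance Definition _ := isHilbert.Build R ell2 ell2_dot_norm.

End ell2_hilbert.

Section weighted_shifts.
Variable R : realType.
Implicit Types (lam : nat -> R) (W : 'B(ell2 R)).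

Let basis_subproof n : (fun k => (k == n)%:R : R[i]) \in @ell2_pred R.
Proof.
apply/ell2_predP; exists 1 => m.
apply: (@le_trans _ _ (\sum_(k < m) (k == n :> nat)%:R)).
  apply: ler_sum => k _; case: eqP => _.
    by rewrite normc1 expr1n.
  by rewrite normc0 expr0n.
have [nm|mn] := ltnP n m.
  rewrite (bigD1 (Ordinal nm)) //= eqxx big1 ?addr0 // => k /negPf.
  by rewrite -val_eqE /= => ->.
rewrite big1 // => k _; case: eqP => // kn.
by move: mn; rewrite -kn leqNgt ltn_ord.
Qed.

Definition ell2_basis n : ell2 R := Ell2 (basis_subproof n).

Definition is_weighted_shift lam W :=
  forall n, W (ell2_basis n) = (lam n)%:C%C *: ell2_basis n.+1.

Lemma is_weighted_shift_exists lam :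
  (forall n, 0 < lam n) -> has_ubound (range lam) ->
  exists W, is_weighted_shift lam W.
Proof.
move=> lam0 [M lamM].
have lamM2 n : lam n ^+ 2 <= M ^+ 2.
  have lM : lam n <= M by apply: lamM; exists n.
  have l0 := ltW (lam0 n); by rewrite lerXn2r ?nnegrE ?(le_trans l0 lM).
pose f (x : nat -> R[i]) k : R[i] := if k is j.+1 then (lam j)%:C%C * x j else 0.
have f_le (x : ell2 R) n : \sum_(k < n) normc (f x k) ^+ 2 <=
    M ^+ 2 * \sum_(k < n) normc (x k) ^+ 2.
  case: n => [|n]; first by rewrite !big_ord0 mulr0.
  rewrite big_ord_recl -[f x ord0]/(0 : R[i]) normc0 expr0n add0r.
  rewrite big_ord_recr mulrDr -[leLHS]addr0; apply: lerD; last first.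
    by apply: mulr_ge0; exact: sqr_ge0.
  rewrite mulr_sumr; apply: ler_sum => k _.
  rewrite -[f x _]/((lam k)%:C%C * x k) normcM exprMn.
  apply: ler_wpM2r; first exact: sqr_ge0.
  by rewrite normc2E /= expr0n addr0.
have f_ell2 (x : ell2 R) : f x \in @ell2_pred R.
  have /ell2_predP [L xL] := ell2P x.
  apply/ell2_predP; exists (M ^+ 2 * L) => n; apply: le_trans (f_le x n) _.
  by apply: ler_wpM2l; [exact: sqr_ge0|exact: xL].
pose T x := Ell2 (f_ell2 x).
have T_lin : linear T.
  move=> w x y; apply: ell2_ext => -[|n].
    by rewrite ell2D ell2Z /= mulr0 addr0.
  by rewrite ell2D ell2Z /= -[(_ + _) n]/(w * x n + y n) mulrDr mulrCA.
have T_bd : exists L : R[i], forall x, `|T x| <= L * `|x|.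
  exists (`|M|%:C)%C => x.
  rewrite -[`|T x|]/(ell2_norm (T x)) -[`|x|]/(ell2_norm x) -rmorphM lecR.
  rewrite -sqrtr_sqr -sqrtrM ?sqr_ge0 // ler_wsqrtr //.
  have cx : cvgn (series (fun n => normc (x n) ^+ 2)).
    by have := ell2P x; rewrite inE.
  have cT : cvgn (series (fun n => normc (T x n) ^+ 2)).
    by have := ell2P (T x); rewrite inE.
  rewrite -[leRHS](lim_seriesZ (M ^+ 2) cx); apply: ler_lim => //.
    exact: is_cvg_seriesZ.
  near=> n; rewrite /series /= -scaler_sumr !big_mkord.
  exact: f_le.
pose TL := GRing.isLinear.Build R[i] (ell2 R) (ell2 R) *:%R T T_lin.
pose TB := isBoundedOperator.Build R (ell2 R) (ell2 R) T T_bd.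
pose Tl : {linear ell2 R -> ell2 R} := HB.pack T TL.
pose W : 'B(ell2 R) := HB.pack T TL TB.
exists W => n; apply: ell2_ext => -[|k].
  by rewrite ell2Z /= mulr0.
rewrite ell2Z /= eqSS; case: eqP => [->//|_]; by rewrite !mulr0.
Unshelve. all: by end_near. Qed.

End weighted_shifts.

Section scalar_triplets.
Variable R : realType.
Implicit Types (lam : nat -> R) (b c : R)
  (nu : {finite_measure set (measurableTypeR R) -> \bar R}).

Definition lam_hat lam n : R := \prod_(k < n) lam k ^+ 2.

(* The sum is empty for n = 0, 1. *)
Definition Qpoly n (x : R) : R := \sum_(j < n.-1) (n - j - 1)%:R * x ^+ j.

(* The closed support. *)
Definition msupport nu : set R :=
  [set x | forall U : set R, open U -> U x -> (0 < nu U)%E].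

(* A measure on [0, +oo[ is represented by a Borel measure on R vanishing on
   ]-oo, 0[. *)
Record scalar_triplet lam b c nu : Prop := {
  triplet_c : 0 <= c ;
  triplet_nneg : nu `]-oo, 0%R[%classic = 0%E ;
  triplet_compact : compact (msupport nu) ;
  triplet_1 : nu [set 1%R] = 0%E ;
  triplet_eq : forall n, (lam_hat lam n)%:E =
    ((1 + b * n%:R + c * n%:R ^+ 2)%:E
      + \int[nu]_(x in `[0%R, +oo[) (Qpoly n x)%:E)%E }.

(* Measures are unconstrained outside the sigma-algebra, so nu = 0 is stated on
   measurable sets. *)
Definition type_I c nu := (forall A, measurable A -> nu A = 0%E) /\ c = 0.

Definition type_II c nu := msupport nu = [set 0] /\ c = 0.

End scalar_triplets.

(* Main.v *)
From HB Require Import structures.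
Require Import Defs.
From mathcomp Require Import all_boot all_order all_algebra complex sesquilinear.
From mathcomp Require Import ring lra zify.
From mathcomp Require Import all_classical all_reals all_analysis.
From mathcomp Require Import measurable_realfun.

Set Implicit Arguments.
Unset Strict Implicit.
Unset Printing Implicit Defensive.

Import Order.TTheory GRing.Theory Num.Theory.
Import numFieldNormedType.Exports.

Local Open Scope classical_set_scope.
Local Open Scope ring_scope.

(** The growth of [hat lambda] decides. In types I and II the measure lives on
[{0}], so that for [n >= 1] the sequence [hat lambda_n] is affine, with some
slope [d]; positivity forces [d >= 0].

If [d = 0] the weights are [(a, 1, 1, ...)] with [a <= 1], and the shift is
subnormal ([shift_a11_subnormal]): it is a part of the orthogonal sum of the
bilateral shift and a one-dimensional zero operator. This case is therefore
excluded by hypothesis.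

If [d > 0] the norms [|W ^ n e_0|] tend to infinity, but at a polynomial rate.
Suppose [Y W = S Y] with [Y] bounded bijective and [S] subnormal, and put
[h = Y e_0]. A subnormal operator is paranormal ([subnormal_paranormal]), so
[n |-> |S ^ n h|] is log-convex; growing at most polynomially, it cannot
increase ([logconvex_linear_growth]), and [|S ^ n h| <= |h|]. The usual
conclusion would be that [Y^-1] is unbounded, against the open mapping theorem.
A single vector gives the contradiction directly. The series
[y = sum_k 2^-k S^(4^k) h] converges, and each of its tails has the form
[S ^ (4 ^ j) z] ([lacunary_tails]). Writing [y = Y x] and using that [Y] is
injective and onto, [x] differs from the partial sum of
[sum_k 2^-k W^(4^k) e_0] by an element of the range of [W ^ (4 ^ j)], whose
first [4 ^ j] coordinates vanish. Hence [x] has coordinates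
[2^-k sqrt (hat lambda_(4^k))], which stay away from [0]: no such [x] lies in
[l^2] ([linear_growth_not_similar]). *)

(** * Real-valued norms, bounded operators and inner products *)

Section hilbert_operators.
Variable R : realType.

Definition rnorm (V : normedModType R[i]) (x : V) : R := complex.Re `|x|.

Section normed_space.
Variable V : normedModType R[i].
Implicit Types x y : V.

Lemma rnormE x : `|x| = (rnorm x)%:C%C.
Proof. by rewrite RRe_real // ger0_real. Qed.

Lemma rnorm_ge0 x : 0 <= rnorm x.
Proof. by rewrite -lecR -rnormE; exact: normr_ge0. Qed.

Lemma rnorm0 : rnorm (0 : V) = 0.
Proof. by rewrite /rnorm normr0. Qed.

Lemma rnormD x y : rnorm (x + y) <= rnorm x + rnorm y.
Proof. by rewrite -lecR rmorphD /= -!rnormE ler_normD. Qed.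

Lemma rnormN x : rnorm (- x) = rnorm x.
Proof. by rewrite /rnorm normrN. Qed.

Lemma rnormZ (r : R) x : rnorm (r%:C%C *: x) = `|r| * rnorm x.
Proof.
apply: (@complexI R); rewrite -rnormE normrZ rmorphM /= -rnormE.
by rewrite normc_def /= expr0n addr0 sqrtr_sqr.
Qed.

Lemma rnorm_sum (I : Type) (r : seq I) (P : pred I) (F : I -> V) :
  rnorm (\sum_(i <- r | P i) F i) <= \sum_(i <- r | P i) rnorm (F i).
Proof.
by elim/big_ind2 : _ => [|x a y b|//]; rewrite ?rnorm0 // => /lerD/[apply];
  apply: le_trans; exact: rnormD.
Qed.

End normed_space.

Lemma bounded_op_rnorm (H K : hilbertType R) (f : 'B(H, K)) :
  exists2 M : R, 0 <= M & forall x, rnorm (f x) <= M * rnorm x.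
Proof.
have [M fM] := @bounded_op R H K f.
exists (complex.Re `|M|) => [|x].
  by rewrite -lecR RRe_real ?ger0_real //; exact: normr_ge0.
(* M need not be real, but M |x| is, since it bounds a norm *)
rewrite -lecR rmorphM /= RRe_real ?ger0_real // -!rnormE.
apply: le_trans (fM x) _.
by rewrite -[leLHS]ger0_norm ?normrM ?normr_id // (le_trans _ (fM x)).
Qed.

Lemma bounded_opZ (H K : hilbertType R) (f : 'B(H, K)) (w : R[i]) x :
  f (w *: x) = w *: f x.
Proof. exact: linearZ. Qed.

Lemma bounded_opB (H K : hilbertType R) (f : 'B(H, K)) x y :
  f (x - y) = f x - f y.
Proof. exact: raddfB. Qed.

Lemma bounded_opD (H K : hilbertType R) (f : 'B(H, K)) x y :
  f (x + y) = f x + f y.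
Proof. exact: raddfD. Qed.

Lemma bounded_op_sum (H K : hilbertType R) (f : 'B(H, K)) n (F : 'I_n -> H) :
  f (\sum_(k < n) F k) = \sum_(k < n) f (F k).
Proof. exact: raddf_sum. Qed.

Lemma dotp_rnorm (H : hilbertType R) (x : H) : dotp x x = (rnorm x ^+ 2)%:C%C.
Proof. by rewrite dotp_norm rnormE rmorphXn. Qed.

Lemma dotpC (H : hilbertType R) (x y : H) : dotp x y = (dotp y x)^*.
Proof. by rewrite (hermC dotp) /= expr0 mul1r. Qed.

Lemma normal_rnorm (H : hilbertType R) (N S : 'B(H)) :
  is_adjoint N S -> N \o S =1 S \o N -> forall z, rnorm (S z) = rnorm (N z).
Proof.
move=> NS com z; apply/eqP; rewrite -(@eqrXn2 _ 2) ?rnorm_ge0 //; apply/eqP.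
apply: (@complexI R); rewrite -!dotp_rnorm -NS -[N (S z)]/((N \o S) z) com /=.
by rewrite dotpC -NS -dotpC.
Qed.

Lemma dotpDl (H : hilbertType R) (x y z : H) :
  dotp (x + y) z = dotp x z + dotp y z.
Proof. exact: linearDl. Qed.

Lemma dotpDr (H : hilbertType R) (x y z : H) :
  dotp z (x + y) = dotp z x + dotp z y.
Proof. exact: linearDr. Qed.

Lemma rnormD_sq (H : hilbertType R) (x y : H) :
  rnorm (x + y) ^+ 2 = rnorm x ^+ 2 + rnorm y ^+ 2 + 2 * complex.Re (dotp x y).
Proof.
have sqE z : rnorm z ^+ 2 = complex.Re (dotp z z) by rewrite dotp_rnorm.
rewrite !sqE dotpDl !dotpDr [dotp y x]dotpC !raddfD /=.
by case: (dotp x y) => u v /=; ring.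
Qed.

(** For the real part, Cauchy-Schwarz is the triangle inequality squared. *)
Lemma Re_dotp_le (H : hilbertType R) (x y : H) :
  complex.Re (dotp x y) <= rnorm x * rnorm y.
Proof.
have := rnormD x y; rewrite -(@ler_pXn2r _ 2) ?nnegrE ?addr_ge0 ?rnorm_ge0 //.
rewrite rnormD_sq sqrrD; lra.
Qed.

Lemma bounded_op_ext (H K : hilbertType R) (f : {linear H -> K}) :
  (exists2 M : R, 0 <= M & forall x, rnorm (f x) <= M * rnorm x) ->
  exists T : 'B(H, K), T =1 f.
Proof.
move=> [M M0 fM].
have f_bd : exists M : R[i], forall x, `|f x| <= M * `|x|.
  by exists M%:C%C => x; rewrite !rnormE -rmorphM lecR.
pose fB := isBoundedOperator.Build R H K f f_bd.
pose T : 'B(H, K) := HB.pack (GRing.Linear.sort f) fB.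
by exists T.
Qed.

Lemma dotpZl (H : hilbertType R) (w : R[i]) (x y : H) :
  dotp (w *: x) y = w * dotp x y.
Proof. exact: linearZl. Qed.

Lemma polarization (H K1 K2 : hilbertType R) (f : {linear H -> K1})
    (g : {linear H -> K2}) :
  (forall x, rnorm (f x) = rnorm (g x)) ->
  forall x y, dotp (f x) (f y) = dotp (g x) (g y).
Proof.
move=> fg.
have reE x y : complex.Re (dotp (f x) (f y)) = complex.Re (dotp (g x) (g y)).
  have := fg (x + y); rewrite !raddfD => /(congr1 (fun r => r ^+ 2)).
  by rewrite !rnormD_sq !fg; lra.
have imE (u : R[i]) : complex.Im u = - complex.Re ('i%C * u).
  by case: u => a b /=; ring.
move=> x y; apply/eqP; rewrite eq_complex reE eqxx !imE -!dotpZl /=.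
by rewrite -!linearZ reE.
Qed.

End hilbert_operators.

(** * Log-convexity of the orbits of a subnormal operator *)

Section log_convexity.
Variable R : realType.

(** The defining inequality of a paranormal operator. For a normal [N],
[|N x|^2 = <x, N^* N x> <= |x| |N^* N x| = |x| |N^2 x|], and a restriction of
[N] to an invariant subspace inherits it. *)
Lemma subnormal_paranormal (H : hilbertType R) (S : 'B(H)) (x : H) :
  subnormal_op S -> rnorm (S x) ^+ 2 <= rnorm x * rnorm (S (S x)).
Proof.
move=> [K [J [N [Jiso [T NT com] NJ]]]].
have Jn z : rnorm (J z) = rnorm z.
  apply/eqP; rewrite -(@eqrXn2 _ 2) ?rnorm_ge0 //; apply/eqP.
  by apply: (@complexI R); rewrite -!dotp_rnorm Jiso.
have JS z : J (S z) = N (J z) by rewrite -[RHS]/((N \o J) z) NJ.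
rewrite -[rnorm x]Jn -[rnorm (S x)]Jn -[rnorm (S (S x))]Jn !JS.
rewrite -[rnorm (N (N _))](normal_rnorm NT com) -[leLHS]/(complex.Re (_%:C%C)) -dotp_rnorm NT.
exact: Re_dotp_le.
Qed.

(** The ratio [a (n+1) / a n] of a log-convex sequence does not decrease; if it
ever exceeds [1], it stays above some [q > 1] and [a] grows geometrically,
which the bound on [a n ^+ 2] excludes. *)
Lemma logconvex_linear_growth (a : nat -> R) (A B : R) :
  (forall n, 0 <= a n) -> (forall n, a n.+1 ^+ 2 <= a n * a n.+2) ->
  (forall n, a n ^+ 2 <= A + B * n%:R) -> forall n, a n.+1 <= a n.
Proof.
move=> a0 aconv agrow m; rewrite leNgt; apply/negP => am.
have am0 : 0 < a m.
  rewrite lt_def a0 andbT; apply/eqP => am0; have := aconv m.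
  rewrite am0 mul0r; apply/negP; rewrite -ltNge exprn_gt0 //.
  by rewrite -[X in X < _]am0.
pose q := a m.+1 / a m.
have q1 : 1 < q by rewrite ltr_pdivlMr // mul1r.
have qstep j : 0 < a (m + j)%N /\ q * a (m + j)%N <= a (m + j).+1.
  elim: j => [|j [IH0 IH]]; first by rewrite addn0 /q mulfVK ?gt_eqF.
  have aS0 : 0 < a (m + j).+1.
    by apply: lt_le_trans IH; rewrite mulr_gt0 // (lt_trans ltr01).
  rewrite addnS; split => //; rewrite -(ler_pM2l IH0).
  apply: le_trans (aconv _); rewrite expr2 mulrA ler_pM2r // mulrC.
  exact: IH.
have qpow j : q ^+ j * a m <= a (m + j)%N.
  elim: j => [|j IH]; first by rewrite expr0 mul1r addn0.
  rewrite addnS; apply: le_trans (qstep j).2.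
  by rewrite exprS -mulrA ler_pM2l // (lt_trans ltr01).
set e := (q - 1) * a m.
have e0 : 0 < e by rewrite mulr_gt0 // subr_gt0.
(* Bernoulli: the quadratic (a m + j e)^2 stays below a linear function of j *)
have ab j : (a m + j%:R * e) ^+ 2 <= A + B * (m + j)%:R.
  apply: le_trans (agrow _); apply: lerXn2r; rewrite ?nnegrE //.
    by apply: addr_ge0 => //; apply: mulr_ge0 (ltW e0).
  apply: le_trans (qpow j).
  elim: j => [|j IH]; first by rewrite mul0r addr0 expr0 mul1r.
  rewrite exprS -mulrA; apply: (@le_trans _ _ (q * (a m + j%:R * e))).
    have -> : q * (a m + j%:R * e) = a m + j.+1%:R * e + (q - 1) * (j%:R * e).
      by rewrite /e -natr1; ring.
    by rewrite lerDl; apply: mulr_ge0; [lra|apply: mulr_ge0 (ltW e0)].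
  by rewrite ler_pM2l // (lt_trans ltr01).
have e2 : 0 < e ^+ 2 by rewrite exprn_gt0.
pose t := (`|A| + `|B| * m%:R + `|B|) / e ^+ 2 + 1.
have t1 : 1 <= t.
  by rewrite lerDr divr_ge0 ?(ltW e2) // !addr_ge0 // mulr_ge0.
have [j tj] : exists j : nat, t < j%:R.
  by exists (Num.bound t); apply: archi_boundP; rewrite (le_trans ler01).
have j1 : 1 <= j%:R :> R by rewrite (le_trans t1) // ltW.
have tE : `|A| + `|B| * m%:R + `|B| = (t - 1) * e ^+ 2.
  by rewrite /t addrK mulfVK // gt_eqF.
have := ab j; apply/negP; rewrite -ltNge.
apply: (@le_lt_trans _ _ ((`|A| + `|B| * m%:R + `|B|) * j%:R)).
  rewrite natrD mulrDr addrA mulrDl; apply: lerD; last first.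
    by apply: ler_wpM2r => //; exact: ler_norm.
  apply: (@le_trans _ _ (`|A| + `|B| * m%:R)).
    by apply: lerD; [|apply: ler_wpM2r => //]; exact: ler_norm.
  by rewrite ler_peMr // addr_ge0 // mulr_ge0.
rewrite tE.
apply: (@lt_le_trans _ _ ((j%:R * e) ^+ 2)).
  have -> : (j%:R * e) ^+ 2 = j%:R * e ^+ 2 * j%:R by ring.
  by rewrite ltr_pM2r ?ltr_pM2r; lra.
have je0 : 0 <= j%:R * e by apply: mulr_ge0 (ltW e0).
by apply: lerXn2r; rewrite ?nnegrE; lra.
Qed.

End log_convexity.

(** * Geometrically dominated series *)

Section geometric_sums.
Variable R : realType.

Lemma geometric_small (C e : R) : 0 < e -> exists n, C * 2^-1 ^+ n < e.
Proof.
move=> e0; have [n nP] : exists n : nat, `|C| / e < n%:R.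
  by exists (Num.bound (`|C| / e)); apply: archi_boundP; rewrite divr_ge0 // ltW.
exists n; apply: le_lt_trans (ler_norm _) _.
rewrite normrM [`|_ ^+ n|]ger0_norm ?exprn_ge0 // exprVn ltr_pdivrMr ?exprn_gt0 //.
rewrite -ltr_pdivrMl // mulrC; apply: (lt_trans nP).
by rewrite -natrX ltr_nat ltn_expl.
Qed.

Lemma geometric_le0 (C a : R) : (forall n, a <= C * 2^-1 ^+ n) -> a <= 0.
Proof.
move=> aC; rewrite leNgt; apply/negP => /(geometric_small C)[n].
by rewrite ltNge aC.
Qed.

(** Convergence is stated with an explicit rate, so that sums can be
identified, and pushed through bounded operators, by estimates alone. *)
Lemma geometric_sum (V : completeNormedModType R[i]) (C : R) (v : nat -> V) :
  (forall k, rnorm (v k) <= C * 2^-1 ^+ k) ->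
  exists s, forall n, rnorm (s - \sum_(k < n) v k) <= 2 * C * 2^-1 ^+ n.
Proof.
move=> vC.
have C0 : 0 <= C by have := vC 0%N; rewrite expr0 mulr1; exact/le_trans/rnorm_ge0.
have tail m n : (m <= n)%N ->
    rnorm (\sum_(m <= k < n) v k) <= 2 * C * 2^-1 ^+ m.
  move=> mn; apply: le_trans (rnorm_sum _ _ _) _.
  suff : \sum_(m <= k < n) rnorm (v k) <= 2 * C * (2^-1 ^+ m - 2^-1 ^+ n).
    by move/le_trans; apply; rewrite ler_wpM2l ?mulr_ge0 // gerBl exprn_ge0.
  elim: n mn => [|n IH]; first by rewrite leqn0 => /eqP ->; rewrite big_geq // subrr mulr0.
  rewrite leq_eqVlt => /predU1P[->|]; first by rewrite big_geq // subrr mulr0.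
  rewrite ltnS => mn; rewrite big_nat_recr //=.
  apply: le_trans (lerD (IH mn) (vC n)) _.
  by rewrite [in leRHS]exprS; lra.
have cv : cvgn (series v).
  apply/cauchy_cvgP/cauchy_seriesP => e e0.
  have /complex_realP [r er] := gtr0_real e0.
  have r0 : 0 < r by rewrite -ltcR -er.
  have [N NP] := geometric_small (2 * C) r0.
  exists ([set n | (N <= n)%N], [set n | (N <= n)%N]).
    by split; exists N.
  move=> [m n] /= [Nm Nn]; have [mn|nm] := leqP m n; last first.
    by rewrite big_geq ?normr0 // ltnW.
  rewrite rnormE er ltcR; apply: le_lt_trans (tail _ _ mn) _.
  apply: le_lt_trans NP; rewrite ler_wpM2l ?mulr_ge0 //.
  by apply: ler_wiXn2l => //; lra.
exists (limn (series v)) => n; apply/ler_addgt0Pr => e e0.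
have e0' : 0 < e%:C%C :> R[i] by rewrite ltcR.
move/cvgrPdist_lt: cv => /(_ _ e0')[N _ NP].
have /NP : (N <= maxn N n)%N by rewrite leq_maxl.
rewrite rnormE ltcR => le.
rewrite (_ : _ - _ = (limn (series v) - series v (maxn N n)) +
   \sum_(n <= k < maxn N n) v k).
  rewrite [leRHS]addrC; apply: le_trans (rnormD _ _) _; apply: lerD; first exact: ltW.
  by apply: tail; rewrite leq_maxr.
by rewrite -sub_series_geq ?leq_maxr // /series /= !big_mkord addrA subrK.
Qed.

End geometric_sums.

(** * Coordinates in l^2 and weighted shifts *)

Section ell2_coordinates.
Variable R : realType.
Implicit Types x y : ell2 R.
Local Notation nsq w := (Normc.normc w ^+ 2).

Lemma ell2_cvg x : cvgn (series (fun n => nsq (x n))).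
Proof. by have := ell2P x; rewrite inE. Qed.

Lemma ell2_rnorm_sq x : rnorm x ^+ 2 = limn (series (fun n => nsq (x n))).
Proof.
rewrite sqr_sqrtr // limr_ge //; first exact: ell2_cvg.
by near=> n; apply: sumr_ge0 => k _; exact: sqr_ge0.
Unshelve. all: by end_near. Qed.

Lemma ell2_sum_le x n : \sum_(k < n) nsq (x k) <= rnorm x ^+ 2.
Proof.
rewrite ell2_rnorm_sq; have := nondecreasing_cvgn_le (nondecreasing_series
  (u_ := fun n => nsq (x n)) (P := xpredT) (fun k _ _ => normc2_ge0 (x k)))
  (@ell2_cvg x) n.
by rewrite /series /= big_mkord.
Qed.

Lemma ell2_rnorm_le x M :
  (forall n, \sum_(k < n) nsq (x k) <= M) -> rnorm x ^+ 2 <= M.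
Proof.
move=> xM; rewrite ell2_rnorm_sq; apply: limr_le; first exact: ell2_cvg.
by near=> n; rewrite /series /= big_mkord.
Unshelve. all: by end_near. Qed.

Lemma ell2_coord_le x n : nsq (x n) <= rnorm x ^+ 2.
Proof.
apply: le_trans (ell2_sum_le x n.+1); rewrite big_ord_recr /= lerDr.
by apply: sumr_ge0 => k _; exact: sqr_ge0.
Qed.

Lemma ell2_coord_cvg0 x (e : R) : 0 < e ->
  exists N, forall n, (N <= n)%N -> nsq (x n) < e.
Proof.
move=> e0; have /cvgr0_norm_lt /(_ e e0) [N _ NP] := cvg_series_cvg_0 (@ell2_cvg x).
by exists N => n /NP; apply: le_lt_trans; exact: ler_norm.
Qed.

Lemma ell2_sumE n (F : 'I_n -> ell2 R) i :
  (\sum_(k < n) F k) i = \sum_(k < n) F k i.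
Proof.
elim: n F => [|n IH] F; first by rewrite !big_ord0.
by rewrite !big_ord_recr ell2D IH.
Qed.

Lemma ell2_basisE n i : ell2_basis R n i = (i == n)%:R.
Proof. by []. Qed.

Lemma rnorm_basis n : rnorm (ell2_basis R n) = 1.
Proof.
apply/eqP; rewrite -(@eqrXn2 _ 2) ?rnorm_ge0 // expr1n eq_le; apply/andP; split.
  apply: ell2_rnorm_le => m; apply: (@le_trans _ _ (\sum_(k < m) (k == n :> nat)%:R)).
    apply: ler_sum => k _; rewrite ell2_basisE; case: eqP => _.
      by rewrite Normc.normc1 expr1n.
    by rewrite Normc.normc0 expr0n.
  elim: m => [|m IH]; first by rewrite big_ord0.
  rewrite big_ord_recr /=; have [->|_] := eqVneq m n; last by rewrite addr0.
  by rewrite big1 ?add0r // => k _; rewrite ltn_eqF.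
have := ell2_coord_le (ell2_basis R n) n.
by rewrite ell2_basisE eqxx Normc.normc1 expr1n.
Qed.

Definition ell2_trunc x m : ell2 R := \sum_(k < m) x k *: ell2_basis R k.

Lemma ell2_truncE x m i : ell2_trunc x m i = if (i < m)%N then x i else 0.
Proof.
rewrite ell2_sumE; case: ltnP => im.
  rewrite (bigD1 (Ordinal im)) // ell2Z ell2_basisE eqxx mulr1.
  rewrite big1 => [|k ki]; first exact: addr0.
  rewrite ell2Z ell2_basisE.
  by move: ki; rewrite -val_eqE eq_sym /= => /negPf ->; rewrite mulr0.
rewrite big1 // => k _; rewrite ell2Z ell2_basisE gtn_eqF ?mulr0 //.
exact: leq_trans im.
Qed.

Lemma ell2_trunc_approx x (e : R) : 0 < e ->
  exists M, forall m, (M <= m)%N -> rnorm (x - ell2_trunc x m) ^+ 2 <= e.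
Proof.
move=> e0; move/cvgrPdist_le: (@ell2_cvg x) => /(_ e e0) [M _ MP].
exists M => m /MP; rewrite -ell2_rnorm_sq => mP; apply: ell2_rnorm_le => n.
have tE k : (x - ell2_trunc x m) k = if (k < m)%N then 0 else x k.
  by rewrite ell2D ell2N ell2_truncE; case: ifP => _; rewrite ?subrr ?subr0.
apply: le_trans mP; apply: le_trans (ler_norm _).
rewrite lerBrDl /series /= big_mkord.
apply: le_trans (ell2_sum_le x (m + n)); rewrite big_split_ord /= lerD2l.
apply: (@le_trans _ _ (\sum_(k < m + n) nsq ((x - ell2_trunc x m) k))).
  rewrite addnC big_split_ord /= lerDl; apply: sumr_ge0 => k _; exact: sqr_ge0.
rewrite big_split_ord big1 => [|k _]; last first.
  by rewrite tE /= ltn_ord Normc.normc0 expr0n.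
rewrite [leLHS]add0r; apply: ler_sum => k _.
by rewrite tE /= ltnNge leq_addr.
Qed.

End ell2_coordinates.

Section weighted_shift.
Variables (R : realType) (lam : nat -> R) (W : 'B(ell2 R)).
Hypothesis W_shift : is_weighted_shift lam W.
Local Notation nsq w := (Normc.normc w ^+ 2).

(** The operator is given on the basis only; its coordinates on an arbitrary
vector follow by density of the finite sequences and boundedness. *)
Lemma weighted_shiftE x i :
  W x i = if i is j.+1 then (lam j)%:C%C * x j else 0.
Proof.
have [M M0 WM] := bounded_op_rnorm W.
set rhs := (X in _ = X).
have truncE m : (i <= m)%N -> W (ell2_trunc x m) i = rhs.
  move=> im; rewrite bounded_op_sum ell2_sumE /rhs.
  case: i im {rhs} => [|j] jm.
    by rewrite big1 // => k _; rewrite bounded_opZ W_shift !ell2Z ell2_basisE /= !mulr0.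
  rewrite (bigD1 (Ordinal jm)) // bounded_opZ W_shift !ell2Z ell2_basisE eqxx.
  rewrite mulr1 mulrC big1 => [|k kj]; first exact: addr0.
  rewrite bounded_opZ W_shift !ell2Z.
  rewrite ell2_basisE eqSS; move: kj; rewrite -val_eqE eq_sym /= => /negPf ->.
  by rewrite !mulr0.
suff d0 : nsq (W x i - rhs) <= 0.
  apply/eqP; rewrite -subr_eq0; apply/eqP/Normc.eq0_normc/eqP.
  by rewrite -sqrf_eq0 eq_le d0 sqr_ge0.
apply/ler_addgt0Pr => e e0; rewrite add0r.
have M1 : 0 < M ^+ 2 + 1 by have := sqr_ge0 M; lra.
have [m mP] := ell2_trunc_approx x (divr_gt0 e0 M1).
have {mP} mP := mP (maxn m i) (leq_maxl _ _).
rewrite -(truncE (maxn m i)) ?leq_maxr // -ell2N -ell2D -bounded_opB.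
apply: le_trans (ell2_coord_le _ i) _.
apply: (@le_trans _ _ ((M * rnorm (x - ell2_trunc x (maxn m i))) ^+ 2)).
  by apply: lerXn2r; rewrite ?nnegrE ?mulr_ge0 ?rnorm_ge0 ?WM.
rewrite exprMn; apply: (@le_trans _ _ (M ^+ 2 * (e / (M ^+ 2 + 1)))).
  by rewrite ler_wpM2l ?sqr_ge0.
by rewrite mulrA ler_pdivrMr // mulrC ler_pM2l // lerDl.
Qed.

Lemma iter_shift_low n x i : (i < n)%N -> iter n W x i = 0.
Proof.
elim: n i => // n IH [|i] lt_in; rewrite iterS weighted_shiftE //.
by rewrite IH ?mulr0.
Qed.

Lemma iter_shift_basis n : iter n W (ell2_basis R 0) =
  (\prod_(k < n) lam k)%:C%C *: ell2_basis R n.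
Proof.
elim: n => [|n IH]; first by rewrite big_ord0 scale1r.
by rewrite iterS IH bounded_opZ W_shift scalerA big_ord_recr /= rmorphM.
Qed.

End weighted_shift.

(** * Shifts of linear growth *)

Section linear_growth.
Variable R : realType.
Local Notation nsq w := (Normc.normc w ^+ 2).

Lemma iter_opZ (H : hilbertType R) (T : 'B(H)) n (w : R[i]) x :
  iter n T (w *: x) = w *: iter n T x.
Proof. by elim: n => //= n ->; rewrite bounded_opZ. Qed.

Lemma iter_opB (H : hilbertType R) (T : 'B(H)) n x y :
  iter n T (x - y) = iter n T x - iter n T y.
Proof. by elim: n => //= n ->; rewrite bounded_opB. Qed.

Lemma iter_op_sum (H : hilbertType R) (T : 'B(H)) n m (F : 'I_m -> H) :
  iter n T (\sum_(k < m) F k) = \sum_(k < m) iter n T (F k).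
Proof. by elim: n => //= n ->; rewrite bounded_op_sum. Qed.

Lemma iter_op_rnorm (H : hilbertType R) (T : 'B(H)) n :
  exists2 M : R, 0 <= M & forall x, rnorm (iter n T x) <= M * rnorm x.
Proof.
have [M M0 TM] := bounded_op_rnorm T; elim: n => [|n [L L0 IH]].
  by exists 1 => // x; rewrite mul1r.
exists (M * L) => [|x]; first exact: mulr_ge0.
by apply: le_trans (TM _) _; rewrite -mulrA ler_wpM2l ?IH.
Qed.

(** If [|T ^ m h|] stays bounded, the tail of the series [sum_k 2^-k T^(4^k) h]
from [k = j] on is itself [T ^ (4 ^ j)] of a vector: every exponent left is at
least [4 ^ j], and factoring it out leaves a series that still converges. *)
Lemma lacunary_tails (H : hilbertType R) (T : 'B(H)) (h : H) (C : R) :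
  (forall n, rnorm (iter n T h) <= C) ->
  exists y, forall j, exists z,
    y = \sum_(k < j) (2^-1 ^+ k)%:C%C *: iter (4 ^ k) T h + iter (4 ^ j) T z.
Proof.
move=> hC.
pose v j k := (2^-1 ^+ (j + k))%:C%C *: iter (4 ^ (j + k) - 4 ^ j) T h.
have vC j k : rnorm (v j k) <= C * 2^-1 ^+ k.
  rewrite rnormZ ger0_norm ?exprn_ge0 // mulrC.
  apply: ler_pM; rewrite ?rnorm_ge0 ?exprn_ge0 //.
  by apply: ler_wiXn2l; rewrite ?leq_addl //; lra.
pose t k := (2^-1 ^+ k)%:C%C *: iter (4 ^ k) T h.
have tC k : rnorm (t k) <= C * 2^-1 ^+ k.
  rewrite rnormZ ger0_norm ?exprn_ge0 // mulrC.
  by apply: ler_wpM2r; rewrite ?exprn_ge0.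
have [y yP] := geometric_sum tC; exists y => j.
have [z zP] := geometric_sum (vC j); exists z.
have vt k : iter (4 ^ j) T (v j k) = t (j + k)%N.
  rewrite iter_opZ -iterD subnKC // leq_pexp2l //; exact: leq_addr.
have [M M0 TM] := iter_op_rnorm T (4 ^ j).
suff d0 : rnorm (y - (\sum_(k < j) t k + iter (4 ^ j) T z)) <= 0.
  apply/eqP; rewrite -subr_eq0 -normr_eq0 rnormE.
  by apply/eqP; congr (_%:C)%C; apply/eqP; rewrite eq_le d0 rnorm_ge0.
apply: (@geometric_le0 _ (2 * C + M * (2 * C))) => n.
rewrite (_ : _ - _ = (y - \sum_(k < j + n) t k)
   - iter (4 ^ j) T (z - \sum_(k < n) v j k)); last first.
  rewrite iter_opB iter_op_sum big_split_ord /=.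
  under [X in _ = _ - (_ - X)]eq_bigr do rewrite vt.
  by rewrite !opprD opprK !addrA [RHS]addrAC subrK.
apply: le_trans (rnormD _ _) _; rewrite rnormN mulrDl -mulrA; apply: lerD.
  apply: le_trans (yP _) _; rewrite -mulrA; apply: ler_wpM2l => //.
  apply: ler_wpM2l; first by have := hC 0%N; exact/le_trans/rnorm_ge0.
  by apply: ler_wiXn2l; rewrite ?leq_addl //; lra.
by apply: le_trans (TM _) _; rewrite -mulrA ler_wpM2l ?zP.
Qed.

(** The exponents [4 ^ k] and the weights [2^-k] are matched: the weights are
summable, so that the series in the orbit of [Y e_0] converges, while
[(2^-k) ^ 2 * 4 ^ k = 1], so that linear growth of [hat lambda] keeps the
coordinates of its preimage under [Y] away from [0]. *)
Lemma linear_growth_not_similar (lam : nat -> R) (W : 'B(ell2 R)) (A B d : R)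
    (K : hilbertType R) (S : 'B(K)) :
  is_weighted_shift lam W -> 0 < d ->
  (forall n, lam_hat lam n <= A + B * n%:R) ->
  (forall n, d * n%:R <= lam_hat lam n) ->
  subnormal_op S -> ~ similar_op W S.
Proof.
move=> W_shift d0 hat_le hat_ge S_sub [Y Ybij YW].
have Yinj := bij_inj Ybij.
have YWn n x : Y (iter n W x) = iter n S (Y x).
  by elim: n => //= n <-; rewrite -[RHS]/((S \o Y) _) -YW.
pose w n := \prod_(k < n) lam k.
have w2 n : w n ^+ 2 = lam_hat lam n by rewrite -prodrXl.
set h := Y (ell2_basis R 0).
have [M M0 YM] := bounded_op_rnorm Y.
have Sh n : rnorm (iter n S h) <= rnorm h.
  elim: n => // n IH; apply: le_trans IH.
  apply: (@logconvex_linear_growth _ (fun n => rnorm (iter n S h))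
    (M ^+ 2 * A) (M ^+ 2 * B)) => [m|m|m]; first exact: rnorm_ge0.
    exact: subnormal_paranormal.
  rewrite /h -YWn (iter_shift_basis W_shift).
  apply: (@le_trans _ _ ((M * `|w m|) ^+ 2)).
    apply: lerXn2r; rewrite ?nnegrE ?mulr_ge0 ?rnorm_ge0 //.
    by apply: le_trans (YM _) _; rewrite rnormZ rnorm_basis mulr1.
  rewrite exprMn real_normK ?num_real // w2 -mulrA -mulrDr.
  by rewrite ler_wpM2l ?sqr_ge0 ?hat_le.
have [y yP] := lacunary_tails Sh.
have [x xy] : exists x, Y x = y.
  by have [Y' _ YK] := Ybij; exists (Y' y).
(* Injectivity of Y turns the decomposition of y into one of x, whose
   remainder has no coordinate below 4 ^ j. *)
have xE k : x (4 ^ k)%N = (2^-1 ^+ k * w (4 ^ k)%N)%:C%C.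
  have [z zE] := yP k.+1.
  have [x' x'z] : exists x', Y x' = z.
    by have [Y' _ YK] := Ybij; exists (Y' z).
  have -> : x = \sum_(i < k.+1) (2^-1 ^+ i)%:C%C *:
      iter (4 ^ i) W (ell2_basis R 0) + iter (4 ^ k.+1) W x'.
    apply: Yinj; rewrite xy zE bounded_opD bounded_op_sum YWn x'z.
    by congr (_ + _); apply: eq_bigr => i _; rewrite bounded_opZ YWn.
  rewrite ell2D (iter_shift_low W_shift) ?ltn_exp2l // addr0 ell2_sumE.
  rewrite big_ord_recr big1 => [|i _].
    rewrite [LHS]add0r ell2Z (iter_shift_basis W_shift) ell2Z ell2_basisE eqxx.
    by rewrite mulr1 rmorphM.
  rewrite ell2Z (iter_shift_basis W_shift) ell2Z ell2_basisE eqn_exp2l //.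
  by rewrite /= gtn_eqF ?ltn_ord // !mulr0.
have [N NP] := ell2_coord_cvg0 x d0.
have /NP : (N <= 4 ^ N)%N by rewrite ltnW // ltn_expl.
apply/negP; rewrite -leNgt xE normc2E /= expr0n addr0 exprMn w2 -exprM mulnC.
apply: le_trans (ler_wpM2l _ (hat_ge _)); last exact: exprn_ge0.
by rewrite mulrCA natrX exprVn exprM -[2 ^+ 2]natrX mulVf ?mulr1 // expf_neq0.
Qed.

End linear_growth.

(** * Partial permutations of the coordinates of l^2 *)

Section partial_permutations.
Variable R : realType.
Implicit Types (x y : ell2 R) (sigma tau : nat -> option nat).
Local Notation nsq w := (Normc.normc w ^+ 2).

Definition partial_inverses sigma tau :=
  forall i j, (sigma i == Some j) = (tau j == Some i).

Lemma partial_inversesC sigma tau :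
  partial_inverses sigma tau -> partial_inverses tau sigma.
Proof. by move=> st i j; rewrite st. Qed.

Lemma partial_permutation_sum_le sigma tau x n : partial_inverses sigma tau ->
  \sum_(i < n) nsq (oapp x 0 (sigma i)) <= rnorm x ^+ 2.
Proof.
move=> st; pose s := pmap sigma (iota 0 n).
have -> : \sum_(i < n) nsq (oapp x 0 (sigma i)) = \sum_(j <- s) nsq (x j).
  rewrite big_pmap -(big_mkord xpredT (fun i => nsq (oapp x 0 (sigma i)))).
  rewrite /index_iota subn0; apply: eq_bigr => i _.
  case: (sigma i) => [//|]; rewrite -[LHS]/(nsq (0 : R[i])).
  by rewrite Normc.normc0 expr0n.
have s_uniq : uniq s.
  apply: (@pmap_uniq _ _ _ (fun j => odflt 0%N (tau j))) (iota_uniq 0 n) => i.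
  case sE: (sigma i) => [j|] //=.
  by move: sE => /eqP; rewrite st => /eqP ->.
pose m := (\max_(j <- s) j).+1.
have sm j : j \in s -> (j < m)%N by move=> js; exact: (@leq_bigmax_seq _ s xpredT id).
have sP : perm_eq s [seq j <- iota 0 m | j \in s].
  apply: uniq_perm => //; first by rewrite filter_uniq ?iota_uniq.
  move=> j; rewrite mem_filter mem_iota add0n /=.
  by case: (boolP (j \in s)) => // /sm ->.
rewrite (perm_big _ sP) big_filter; apply: le_trans (ell2_sum_le x m).
rewrite -(big_mkord xpredT (fun i => nsq (x i))) /index_iota subn0 big_mkcond.
by apply: ler_sum => j _; case: ifP => // _; exact: sqr_ge0.
Qed.

Lemma partial_permutation_op sigma tau : partial_inverses sigma tau ->
  exists2 C : 'B(ell2 R), (forall x i, C x i = oapp x 0 (sigma i)) &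
    forall x, rnorm (C x) <= rnorm x.
Proof.
move=> st.
have c_ell2 x : (fun i => oapp x 0 (sigma i)) \in @ell2_pred R.
  apply/ell2_predP; exists (rnorm x ^+ 2) => n.
  exact: (partial_permutation_sum_le _ _ st).
pose c x := Ell2 (c_ell2 x).
have c_lin : linear c.
  move=> w x y; apply: ell2_ext => i; rewrite ell2D ell2Z /=.
  by case: (sigma i) => //=; rewrite mulr0 addr0.
have c_le x : rnorm (c x) <= rnorm x.
  rewrite -(@ler_pXn2r _ 2) ?nnegrE ?rnorm_ge0 //.
  apply: ell2_rnorm_le => n; exact: (partial_permutation_sum_le _ _ st).
pose cL := GRing.isLinear.Build R[i] (ell2 R) (ell2 R) *:%R c c_lin.
pose cl : {linear ell2 R -> ell2 R} := HB.pack c cL.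
have [|C CE] := @bounded_op_ext R _ _ cl.
  by exists 1 => // x; rewrite mul1r; exact: c_le.
by exists C => x; rewrite CE //; exact: c_le.
Qed.

Lemma eq_dot_termwise (x x' y y' : ell2 R) :
  (forall i, x i * (y i)^* = x' i * (y' i)^*) -> dotp x y = dotp x' y'.
Proof.
move=> xy; rewrite -[LHS]/(ell2_dot x y) -[RHS]/(ell2_dot x' y') /ell2_dot.
by under eq_fun do rewrite xy; under [X in (_ +i* limn (series X))%C]eq_fun do rewrite xy.
Qed.

(** [D o C] is the projection onto the coordinates in the range of [sigma], and
[C] has the same norms as that projection, because both operators are
contractions; polarization turns this into the adjoint relation, with no
rearrangement of series. *)
Lemma partial_permutation_adjoint sigma tau (C D : 'B(ell2 R)) :
  partial_inverses sigma tau ->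
  (forall x i, C x i = oapp x 0 (sigma i)) -> (forall x, rnorm (C x) <= rnorm x) ->
  (forall x i, D x i = oapp x 0 (tau i)) -> (forall x, rnorm (D x) <= rnorm x) ->
  is_adjoint C D.
Proof.
move=> st CE C_le DE D_le x y.
have DCE z j : D (C z) j = if tau j is Some _ then z j else 0.
  rewrite DE; case tE: (tau j) => [i|] //=; rewrite CE.
  by move: tE => /eqP; rewrite -st => /eqP ->.
have CDE z i : C (D z) i = if sigma i is Some _ then z i else 0.
  rewrite CE; case sE: (sigma i) => [j|] //=; rewrite DE.
  by move: sE => /eqP; rewrite st => /eqP ->.
have CDC z : C (D (C z)) = C z.
  by apply: ell2_ext => i; rewrite CDE !CE; case: (sigma i).
have norm_eq z : rnorm (C z) = rnorm ((D \o C) z).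
  apply/eqP; rewrite eq_le D_le andbT -[in leLHS]CDC; exact: C_le.
rewrite (@eq_dot_termwise _ (C x) _ (C (D y))); last first.
  move=> i; rewrite CDE CE; case: (sigma i) => //=; by rewrite !mul0r.
rewrite (polarization norm_eq); apply: eq_dot_termwise => j /=.
by rewrite !DCE DE; case: (tau j) => //=; rewrite mul0r rmorph0 mulr0.
Qed.

End partial_permutations.

(** * A normal extension of the shift with weights (a, 1, 1, ...) *)

Section subnormal_shift.
Variable R : realType.
Local Notation nsq w := (Normc.normc w ^+ 2).

(** A bilateral shift on [l^2(Z)] together with a null vector [f_*], carried by
[l^2(Z_+)]: coordinate [0] stands for [f_*], coordinate [2n+1] for [f_n] and
coordinate [2n+2] for [f_(-n-1)]. Coordinate [i] of the image of [x] is
coordinate [bilateral_pred i] of [x], and [0] when that is [None]; the adjoint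
uses [bilateral_succ] instead. *)
Definition bilateral_pred i : option nat :=
  match i with
  | 0 => None | 1 => Some 2%N
  | k.+2 => Some (if odd k then k else k.+4)
  end.

Definition bilateral_succ i : option nat :=
  match i with
  | 0 => None | 1 => Some 3%N | 2 => Some 1%N
  | k.+3 => Some (if odd k then k.+1 else k.+4.+1)
  end.

Lemma bilateral_inverses : partial_inverses bilateral_pred bilateral_succ.
Proof.
move=> i j; apply/eqP/eqP; case: i => [|[|i]]; case: j => [|[|[|j]]] //= [];
  by repeat case: ifP => ?; move=> ?; first [congr Some; lia | exfalso; lia].
Qed.

Variable a : R.
Hypotheses (a_ge0 : 0 <= a) (a_le1 : a <= 1).

(** The image of [x] under [e_0 |-> a f_0 + sqrt (1 - a^2) f_*] and
[e_n |-> f_n] for [n >= 1], in the numbering above. *)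
Definition embed_seq (x : nat -> R[i]) i : R[i] :=
  if i is k.+1 then
    if odd k then 0 else (if k == 0%N then a else 1)%:C%C * x k./2
  else (Num.sqrt (1 - a ^+ 2))%:C%C * x 0%N.

Lemma embed_seq_sum x n :
  \sum_(i < n.*2.+3) nsq (embed_seq x i) = \sum_(k < n.+1) nsq (x k).
Proof.
have nsqZ (r : R) (w : R[i]) : nsq (r%:C%C * w) = r ^+ 2 * nsq w.
  by rewrite Normc.normcM exprMn [nsq _%:C%C]normc2E /= expr0n addr0.
have nsq0 : nsq (0 : R[i]) = 0 by rewrite Normc.normc0 expr0n.
have a2 : a ^+ 2 <= 1 by rewrite expr_le1.
have sumSr (f : nat -> R) m : \sum_(k < m.+1) f k = \sum_(k < m) f k + f m.
  by rewrite big_ord_recr.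
elim: n => [|n IH].
  rewrite (sumSr (fun k => nsq (x k))) !(sumSr (fun i => nsq (embed_seq x i))).
  rewrite !big_ord0 !add0r.
  rewrite -[embed_seq x _]/((Num.sqrt (1 - a ^+ 2))%:C%C * x 0%N).
  rewrite -[embed_seq x 1]/(a%:C%C * x 0%N) -[embed_seq x 2]/(0 : R[i]).
  rewrite nsq0 !nsqZ sqr_sqrtr ?subr_ge0 //; ring.
rewrite doubleS !(sumSr (fun i => nsq (embed_seq x i))) in IH *.
rewrite IH [RHS](sumSr (fun k => nsq (x k))).
have -> : embed_seq x n.*2.+3 = 1%:C%C * x n.+1.
  by rewrite /embed_seq /= odd_double /= doubleK.
have -> : embed_seq x n.*2.+4 = 0 by rewrite /embed_seq /= odd_double.
by rewrite nsq0 nsqZ expr1n mul1r addr0.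
Qed.

Lemma embed_seq_le (x : nat -> R[i]) n M : (forall m, \sum_(k < m) nsq (x k) <= M) ->
  \sum_(i < n) nsq (embed_seq x i) <= M.
Proof.
move=> xM; apply: le_trans (xM n.+1); rewrite -embed_seq_sum.
have nn : (n <= n.*2.+3)%N by lia.
rewrite -(subnKC nn) big_split_ord lerDl.
by apply: sumr_ge0 => i _; exact: sqr_ge0.
Qed.

Lemma embed_op : exists2 J : {linear ell2 R -> ell2 R},
  (forall x i, J x i = embed_seq x i) & forall x, rnorm (J x) = rnorm x.
Proof.
have j_ell2 (x : ell2 R) : embed_seq x \in @ell2_pred R.
  apply/ell2_predP; exists (rnorm x ^+ 2) => n.
  by apply: embed_seq_le => m; exact: ell2_sum_le.
pose j x := Ell2 (j_ell2 x).
have j_lin : linear j.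
  move=> w x y; apply: ell2_ext => i; rewrite ell2D ell2Z.
  rewrite -[LHS]/(embed_seq (fun k => w * x k + y k) i).
  rewrite -[j x i]/(embed_seq x i) -[j y i]/(embed_seq y i) /embed_seq.
  case: i => [|k]; first by rewrite mulrDr mulrCA.
  by case: ifP => _; rewrite ?mulr0 ?addr0 // mulrDr mulrCA.
pose jL := GRing.isLinear.Build R[i] (ell2 R) (ell2 R) *:%R j j_lin.
pose J : {linear ell2 R -> ell2 R} := HB.pack j jL.
exists J => // x; apply/eqP; rewrite -(@eqrXn2 _ 2) ?rnorm_ge0 // eq_le.
apply/andP; split; apply: ell2_rnorm_le => n.
  by apply: embed_seq_le => m; exact: ell2_sum_le.
apply: (@le_trans _ _ (\sum_(k < n.+1) nsq (x k))).
  by rewrite big_ord_recr lerDl; exact: sqr_ge0.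
rewrite -embed_seq_sum; exact: (ell2_sum_le (J x)).
Qed.

(** The bilateral shift sends [a f_0 + sqrt (1 - a^2) f_*] to [a f_1], since it
kills [f_*], and [f_n] to [f_(n+1)]: it acts on these vectors with the weights
[a, 1, 1, ...]. The component along [f_*] makes the first of them a unit
vector, which is where [a <= 1] is needed. *)
Lemma shift_a11_subnormal (lam : nat -> R) (W : 'B(ell2 R)) :
  is_weighted_shift lam W -> lam 0%N = a -> (forall n, lam n.+1 = 1) ->
  subnormal_op W.
Proof.
move=> W_shift lam0 lam1.
have inv := bilateral_inverses; have inv' := partial_inversesC inv.
have [N NE N_le] := partial_permutation_op R inv.
have [N' NE' N_le'] := partial_permutation_op R inv'.
have [J JE J_norm] := embed_op.
exists (ell2 R), J, N; split.
- move=> x y; exact: (polarization (g := idfun) J_norm).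
- exists N'; first exact: (partial_permutation_adjoint inv).
  move=> x; apply: ell2_ext => i /=.
  have opK k sigma tau (C D : 'B(ell2 R)) : partial_inverses sigma tau ->
      (forall x i, C x i = oapp x 0 (sigma i)) ->
      (forall x i, D x i = oapp x 0 (tau i)) ->
      C (D x) k = if sigma k is Some _ then x k else 0.
    move=> st CE DE; rewrite CE; case sE: (sigma k) => [j|] //=; rewrite DE.
    by move: sE => /eqP; rewrite st => /eqP ->.
  rewrite (opK _ _ _ _ _ inv NE NE') (opK _ _ _ _ _ inv' NE' NE).
  by case: i => [|[|[|i]]].
move=> x; apply: ell2_ext => i /=; rewrite NE JE.
have WE := weighted_shiftE W_shift x.
case: i => [|[|k]] /=.
- by rewrite WE mulr0.
- by rewrite JE /= WE mulr0.
rewrite JE; case: (boolP (odd k)) => [|k_even]; last first.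
  by rewrite /embed_seq /= k_even.
case: k => // k /= k_even; rewrite (negPf k_even) /= WE mul1r.
by case: k k_even => [|[|k]] // _; rewrite /= ?lam0 ?lam1.
Qed.

End subnormal_shift.

(** * Triplets of types I and II *)

Section triplet.
Variable R : realType.
Implicit Types (nu : {finite_measure set (measurableTypeR R) -> \bar R}).

(** The complement of the support is a union of null open sets; being covered
by countably many of them, namely rational intervals, it is null. *)
Lemma null_off_support nu : msupport nu = [set 0] -> nu (~` [set 0]) = 0%E.
Proof.
move=> supp.
pose F k : set R := if (unpickle k : option (rat * rat)) is Some (p, q) then
  if nu `]ratr p, ratr q[%classic == 0%E then `]ratr p, ratr q[%classic else set0
  else set0.
have F_null k : nu.-negligible (F k).
  rewrite /F; case: (unpickle k) => [[p q]|]; last exact: negligible_set0.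
  case: eqP => [pq0|_]; last exact: negligible_set0.
  by apply/negligibleP => //; exact: measurable_itv.
have m0 : measurable (~` [set 0] : set (measurableTypeR R)).
  by apply: measurableC; exact: measurable_set1.
apply: (negligibleP nu m0).1.
apply: (negligibleS _ (negligible_bigcup F_null)) => x x0.
have : ~ msupport nu x by rewrite supp.
move=> /existsNP [U] /not_implyP [Uo] /not_implyP [Ux /negP].
rewrite lt0e measure_ge0 andbT negbK => /eqP U0.
have /nbhs_ballP [e /= e0 eU] : nbhs x U by exact: open_nbhs_nbhs.
have [p] : exists p : rat, ratr p \in `]x - e, x[.
  by apply: rat_in_itvoo; rewrite gtrBl.
have [q] : exists q : rat, ratr q \in `]x, x + e[.
  by apply: rat_in_itvoo; rewrite ltrDl.
rewrite !in_itv /= => /andP[xq qe] /andP[ep px].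
exists (pickle (p, q)); first by [].
rewrite /F pickleK.
suff -> : nu `]ratr p, ratr q[%classic = 0%E by rewrite eqxx /= in_itv /= px xq.
have mI : measurable (`]ratr p, ratr q[%classic : set (measurableTypeR R)).
  exact: measurable_itv.
have mU : measurable (U : set (measurableTypeR R)) by exact: open_measurable.
apply: (subset_measure0 mI mU _ U0) => y /=.
rewrite in_itv /= => /andP[py yq]; apply: eU.
by rewrite /ball /= ltr_norml; lra.
Qed.

Lemma Qpoly_ge0 n (x : R) : 0 <= x -> 0 <= Qpoly n x.
Proof. by move=> x0; apply: sumr_ge0 => j _; rewrite mulr_ge0 ?exprn_ge0. Qed.

Lemma measurable_Qpoly n D : measurable D ->
  measurable_fun D (Qpoly n : measurableTypeR R -> measurableTypeR R).
Proof.
move=> mD; rewrite /Qpoly; apply: measurable_sum => j.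
by apply: measurable_funM; [exact: measurable_cst|exact: measurable_funX].
Qed.

Lemma Qpoly0 n : Qpoly n.+1 0 = n%:R :> R.
Proof.
rewrite /Qpoly; case: n => [|n]; first by rewrite big_ord0.
rewrite big_ord_recl expr0 mulr1 big1 ?addr0 => [|j _]; last first.
  by rewrite exprS mul0r mulr0.
by congr (_%:R); lia.
Qed.

Lemma integral_Qpoly nu n : nu (~` [set 0]) = 0%E ->
  (\int[nu]_(x in `[0%R, +oo[) (Qpoly n x)%:E =
   (Qpoly n 0 * fine (nu [set 0]))%:E)%E.
Proof.
move=> nu0; have m0 : measurable ([set 0] : set (measurableTypeR R)).
  exact: measurable_set1.
have D0 : `[0%R, +oo[%classic `\` ~` [set 0] = [set 0] :> set R.
  apply/seteqP; split=> [x [_ /contrapT]|x ->] //=.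
  by split; [rewrite in_itv /= lexx|exact].
have mN : measurable (~` [set 0] : set (measurableTypeR R)) by exact: measurableC.
rewrite (ge0_negligible_integral mN) //.
- rewrite D0 (eq_integral (cst (Qpoly n 0)%:E)) => [|x].
    by rewrite integral_cst // EFinM fineK // fin_num_measure.
  by rewrite inE /= => ->.
- by apply/measurable_EFinP; exact: measurable_Qpoly.
- by move=> x /=; rewrite in_itv /= andbT lee_fin; exact: Qpoly_ge0.
Qed.

(** In types I and II only the mass at [0] survives, and [hat lambda] is affine
from [n = 1] on. *)
Lemma type_I_II_affine lam b c nu : scalar_triplet lam b c nu ->
  type_I c nu \/ type_II c nu ->
  exists2 theta : R, 0 <= theta & forall n,
    lam_hat lam n.+1 = 1 - theta + (b + theta) * n.+1%:R.
Proof.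
move=> tri typ.
have [nu0 c0] : nu (~` [set 0]) = 0%E /\ c = 0.
  case: typ => -[]; last by move=> /null_off_support.
  by move=> nu0 ->; split=> //; apply/nu0/measurableC; exact: measurable_set1.
exists (fine (nu [set 0])) => [|n]; first exact/fine_ge0/measure_ge0.
apply: EFin_inj; rewrite (triplet_eq tri) integral_Qpoly // -EFinD c0 Qpoly0.
by congr (_%:E); rewrite -natr1; ring.
Qed.

End triplet.

Theorem proposition2p2p3 (R : realType) (lam : nat -> R) (W : 'B(ell2 R))
    (b c : R) (nu : {finite_measure set (measurableTypeR R) -> \bar R})
    (lam_gt0 : forall n, 0 < lam n) (lam_bounded : has_ubound (range lam))
    (W_shift : is_weighted_shift lam W) (W_cpd : cpd_op W)
    (W_triplet : scalar_triplet lam b c nu)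
    (W_type : type_I c nu \/ type_II c nu)
    (W_nsub : ~ subnormal_op W) :
  forall (K : hilbertType R) (S : 'B(K)), subnormal_op S -> ~ similar_op W S.
Proof.
move=> K S.
have [theta theta0 hatE] := type_I_II_affine W_triplet W_type.
have hat0 : lam_hat lam 0 = 1 by rewrite /lam_hat big_ord0.
have hatS n : lam_hat lam n.+1 = lam_hat lam n * lam n ^+ 2.
  by rewrite /lam_hat big_ord_recr.
have hat_gt0 n : 0 < lam_hat lam n.
  by apply: prodr_gt0 => k _; rewrite exprn_gt0.
set d := b + theta in hatE.
have hat1 : 1 - theta = lam_hat lam 1 - d by rewrite hatE mulr1 addrK.
have [d_lt0|d_gt0|d0] := ltgtP d 0.
-
  (* with a negative slope hat lambda would become negative *)
  pose t := (1 - theta) / - d.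
  have [n tn] : exists n : nat, t < n.+1%:R.
    exists (Num.bound `|t|); apply: (le_lt_trans (ler_norm t)).
    by apply: lt_trans (archi_boundP (normr_ge0 t)) _; rewrite ltr_nat.
  have := hat_gt0 n.+1; rewrite hatE => /lt_geF; move=> /negP[].
  move: tn; rewrite ltr_pdivrMr; lra.
- pose p := lam_hat lam 1.
  have p0 : 0 < p := hat_gt0 1%N.
  have hatSE n : lam_hat lam n.+1 = p + d * n%:R.
    by rewrite hatE hat1 -natr1 /p; ring.
  have m0 : 0 < Num.min p d by rewrite lt_min p0.
  apply: (linear_growth_not_similar (A := 1 + p) (B := d) W_shift m0) => -[|n].
  + by rewrite hat0 mulr0 addr0; lra.
  + by rewrite hatSE -natr1 mulrDr mulr1; lra.
  + by rewrite mulr0 ltW.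
  + rewrite hatSE -natr1 mulrDr mulr1 addrC; apply: lerD.
      by rewrite ge_min lexx.
    by rewrite ler_wpM2r // ge_min lexx orbT.
-
  (* hat lambda is constant from n = 1 on: the weights are (a, 1, 1, ...) *)
  case: W_nsub.
  have lam1 n : lam n.+1 = 1.
    have := hatS n.+1; rewrite !hatE d0 !mul0r addr0.
    have h0 : 1 - theta != 0.
      by have := hat_gt0 1%N; rewrite hatE d0 mul0r addr0 => /lt0r_neq0.
    rewrite -[LHS]mulr1 => /(mulfI h0)/esym/eqP.
    by rewrite sqrp_eq1 ?ltW // => /eqP.
  apply: (@shift_a11_subnormal _ (lam 0%N)) W_shift _ lam1 => //; first exact: ltW.
  have := hatS 0%N; rewrite hat0 mul1r hatE d0 mul0r addr0 => lam2.
  by rewrite -(@expr_le1 _ 2) ?(ltW (lam_gt0 _)) // -lam2 gerBl.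
Qed.
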